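(* Let $n\ge 1$ and let $f,g:\mathbb{C}^n\to\mathbb{C}$ be two polynomials. If $f$ and $g$ are weakly rugose equivalent at infinity, then $\deg(f)=\deg(g)$.
   Context: $\|\cdot\|$ is the Euclidean norm (the modulus on $\mathbb{C}$), and $\deg$ is the total degree of a polynomial. Two polynomial mappings $F,G:\mathbb{C}^n\to\mathbb{C}^m$ are weakly rugose equivalent at infinity if there are compact subsets $K,\widetilde K\subset\mathbb{C}^n$, constants $C_1,C_2>0$ and a bijection $\varphi:\mathbb{C}^n\setminus K\to\mathbb{C}^n\setminus\widetilde K$ (not assumed continuous) such that (1) there exist $y_0\in\mathbb{C}^n\setminus K$ and $w_0\in\mathbb{C}^n\setminus\widetilde K$ such that $\|\varphi(x)-\varphi(y_0)\|\leq C_1\|x-y_0\|$ for all $x\in\mathbb{C}^n\setminus K$, and $\|\varphi^{-1}(z)-\varphi^{-1}(w_0)\|\leq C_1\|z-w_0\|$ for all $z\in\mathbb{C}^n\setminus\widetilde K$; (2) $\frac{1}{C_2}\|F(x)\|\leq\|G\circ\varphi(x)\|\leq C_2\|F(x)\|$ for all $x\in\mathbb{C}^n\setminus K$. *)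

(* Defs.v *)
From HB Require Import structures.
From mathcomp Require Import all_boot all_order all_algebra complex.
From mathcomp Require Import boolp classical_sets functions reals.
From mathcomp Require Import topology normedtype.
(* The notations of mpoly clash with those of mathcomp-analysis. *)
From mathcomp Require Import -(notations) mpoly.

Set Implicit Arguments.
Unset Strict Implicit.
Unset Printing Implicit Defensive.

Import Order.TTheory GRing.Theory Num.Theory.
Import numFieldNormedType.Exports.

Local Open Scope classical_set_scope.
Local Open Scope ring_scope.
Local Open Scope complex_scope.

(* C^n.  The regular module R[i]^o, unlike the bare R[i], carries the topology
   given by the modulus, so that C^n gets the product topology. *)
Definition Cspace (R : realType) (n : nat) := 'rV[R[i]^o]_n.

(* The norm that the library puts on row vectors is the sup norm. *)
Definition euclid_norm (R : realType) (n : nat) (x : Cspace R n) : R :=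
  Num.sqrt (\sum_(i < n) ComplexField.Normc.normc (x ord0 i) ^+ 2).

Definition poly_map (R : realType) (n m : nat)
    (F : m.-tuple (mpoly n R[i])) (x : Cspace R n) : Cspace R m :=
  \row_(j < m) meval (fun i : 'I_n => (x ord0 i : R[i])) (tnth F j).

(* phi is a bijection from ~` K onto ~` K'; its values on K, and those of
   phi^-1 on K', are irrelevant. *)
Definition weakly_rugose_equiv_infty (R : realType) (n m : nat)
    (F G : m.-tuple (mpoly n R[i])) : Prop :=
  exists (K K' : set (Cspace R n)) (C1 C2 : R)
         (phi : {splitbij ~` K >-> ~` K'}),
    [/\ compact (K : set 'rV[R[i]^o]_n), compact (K' : set 'rV[R[i]^o]_n),
        0 < C1, 0 < C2 &
        (exists y0 w0 : Cspace R n,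
          [/\ (~` K) y0, (~` K') w0,
              forall x, (~` K) x ->
                euclid_norm (phi x - phi y0) <= C1 * euclid_norm (x - y0) &
              forall z, (~` K') z ->
                euclid_norm (phi^-1%FUN z - phi^-1%FUN w0)
                  <= C1 * euclid_norm (z - w0)])
        /\
        (forall x, (~` K) x ->
          C2^-1 * euclid_norm (poly_map F x) <= euclid_norm (poly_map G (phi x))
            <= C2 * euclid_norm (poly_map F x))].

(* Main.v *)
(* If |psi x| = O(|x|) outside a compact set and |f| <= C |g o psi| there, then
   |f x| = O(|x|^deg g), so deg f <= deg g: the growth of f is tested along a ray
   t |-> t v on which the top-degree form of f does not vanish.  This applies to
   psi = phi, and to psi = phi^-1 with f and g exchanged. *)
Require Import Defs.
From mathcomp Require Import all_boot all_order all_algebra complex ring.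
From mathcomp Require Import finmap.
From mathcomp Require Import boolp classical_sets functions reals.
From mathcomp Require Import topology normedtype.
From mathcomp Require Import -(notations) mpoly.

Set Implicit Arguments.
Unset Strict Implicit.
Unset Printing Implicit Defensive.

Import Order.TTheory GRing.Theory Num.Theory.
Import numFieldNormedType.Exports.

Local Open Scope classical_set_scope.
Local Open Scope ring_scope.
Local Open Scope complex_scope.

Local Notation normc := ComplexField.Normc.normc.

(** Base-[B] expansions are unique: the remainder mod [B] isolates the lowest digit and the quotient
    carries the others, whence induction on [n]. *)
Lemma digits_inj (B n : nat) (a b : 'I_n -> nat) :
  (forall i, a i < B)%N -> (forall i, b i < B)%N ->
  (\sum_(i < n) a i * B ^ i = \sum_(i < n) b i * B ^ i)%N -> a =1 b.
Proof.
elim: n a b => [|n IHn] a b aB bB; first by move=> _ [].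
have shift (c : 'I_n.+1 -> nat) : (\sum_(i < n.+1) c i * B ^ i =
    (\sum_(i < n) c (lift ord0 i) * B ^ i) * B + c ord0)%N.
  rewrite big_ord_recl expn0 muln1 addnC; congr (_ + _)%N.
  by rewrite big_distrl; apply: eq_bigr => i _; rewrite /= expnSr mulnA.
rewrite !shift => eq_ab.
have B_gt0 : (0 < B)%N by apply: leq_ltn_trans (aB ord0).
have eq0 : a ord0 = b ord0.
  by have := congr1 (modn^~ B) eq_ab; rewrite /= !modnMDl !modn_small.
have eqS : a \o lift ord0 =1 b \o lift ord0.
  apply: IHn => [i|i|]; [exact: aB|exact: bB|].
  by have := congr1 (divn^~ B) eq_ab; rewrite /= !divnMDl // !divn_small // !addn0.
by move=> i; case: (unliftP ord0 i) => [j ->|->] //; apply: eqS.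
Qed.

(** Multiplying by ['X] makes 0 a root, so any non-root of [q * 'X] serves. One lies among the first
    [size (q * 'X)] naturals, which are distinct in [K] and too many to be all roots. *)
Lemma poly_nonroot_neq0 (K : numFieldType) (q : {poly K}) :
  q != 0 -> exists2 s, s != 0 & q.[s] != 0.
Proof.
move=> q0; have qX0 : q * 'X != 0 by rewrite mulf_neq0 ?polyX_eq0.
pose r := [seq (i%:R : K) | i <- iota 0 (size (q * 'X)%R)].
have Ur : uniq r.
  by rewrite map_inj_uniq ?iota_uniq // => i j /eqP; rewrite eqr_nat => /eqP.
have : ~~ all (root (q * 'X)) r.
  by apply/negP => /(max_poly_roots qX0) /(_ Ur); rewrite size_map size_iota ltnn.
case/allPn => s _; rewrite rootM rootX negb_or => /andP[qs s0].
by exists s => //; apply: qs.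
Qed.

(** The homogeneous component of [f] of degree [deg f], evaluated at [v]. *)
Definition top_form (K : nzRingType) (n : nat) (f : mpoly n K) (v : 'I_n -> K) : K :=
  \sum_(m <- msupp f | (mdeg m).+1 == msize f) mcoeff m f * \prod_i v i ^+ m i.

(* Kronecker substitution: at v_i = s^(B^i), distinct monomials of f with all exponents
   below B become distinct powers of s. *)
Lemma top_form_neq0 (K : numFieldType) (n : nat) (f : mpoly n K) :
  f != 0 -> exists2 v, forall i, v i != 0 & top_form f v != 0.
Proof.
move=> f0; pose B := msize f.
pose k (m : multinom n) := (\sum_(i < n) m i * B ^ i)%N.
have mB m : m \in msupp f -> forall i, (m i < B)%N.
  move=> /msize_mdeg_lt mf i; apply: leq_ltn_trans mf.
  by rewrite mdegE (bigD1 i) //= leq_addr.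
have kI m1 m2 : m1 \in msupp f -> m2 \in msupp f -> k m1 = k m2 -> m1 = m2.
  by move=> m1f m2f /(digits_inj (mB _ m1f) (mB _ m2f)) eqm; apply/mnmP.
pose q : {poly K} :=
  \sum_(m <- msupp f | (mdeg m).+1 == msize f) mcoeff m f *: 'X^(k m).
have q0 : q != 0.
  (* By injectivity of [k] on the support, only the leading monomial contributes to the coefficient
     of degree [k (mlead f)], which is thus the nonzero leading coefficient of [f]. *)
  apply/negP => /eqP /(congr1 (fun p : {poly K} => p`_(k (mlead f)))).
  rewrite coef0 coef_sum -big_filter (bigD1_seq (mlead f)); last first.
  - by rewrite filter_uniq ?msupp_uniq.
  - by rewrite mem_filter mlead_supp // mlead_deg //= eqxx.
  rewrite /= coefZ coefXn eqxx mulr1 big_seq_cond big1 ?addr0 => [/eqP|m].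
    by rewrite mleadc_eq0 (negbTE f0).
  rewrite mem_filter => /andP[/andP[_ mf] ml]; rewrite coefZ coefXn.
  case: eqP => [/kI e|_]; last by rewrite mulr0.
  by rewrite e ?mlead_supp ?eqxx in ml.
have [s s0 qs] := poly_nonroot_neq0 q0.
(* Nonzero coordinates will let the ray through [v] escape a bounded set along any single
   coordinate. *)
exists (fun i : 'I_n => s ^+ (B ^ i)) => [i|]; first by rewrite expf_neq0.
suff <- : q.[s] = top_form f (fun i : 'I_n => s ^+ (B ^ i)) by [].
rewrite horner_sum; apply: eq_bigr => m _; rewrite hornerZ hornerXn.
by congr (_ * _); rewrite -prodrXr; apply: eq_bigr => i _; rewrite -exprM mulnC.
Qed.

(** Each monomial is at most a constant times [t ^+ mdeg m], and [t >= 1] lets the top degree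
    dominate. The factor [t] on the left makes the exponent [msize g], so that [g = 0] needs no
    separate treatment. *)
Lemma meval_growth (K : numFieldType) (n : nat) (g : mpoly n K) (M : K) :
  0 <= M -> exists2 C, 0 <= C & forall (t : K) (z : 'I_n -> K), 1 <= t ->
    (forall i, `|z i| <= M * t) -> t * `|meval z g| <= C * t ^+ msize g.
Proof.
move=> M0; exists (\sum_(m <- msupp g) `|mcoeff m g| * M ^+ mdeg m).
  by apply: sumr_ge0 => m _; rewrite mulr_ge0 ?exprn_ge0.
move=> t z t1 zM; have t0 : 0 <= t by apply: le_trans t1.
rewrite mevalE big_distrl /= (le_trans (ler_wpM2l t0 (ler_norm_sum _ _ _))) //.
rewrite big_distrr /= big_seq [X in _ <= X]big_seq; apply: ler_sum => m mg.
rewrite normrM mulrCA -mulrA ler_wpM2l // normr_prod.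
apply: (@le_trans _ _ (t * (M * t) ^+ mdeg m)).
  rewrite ler_wpM2l // mdegE -prodrXr; apply: ler_prod => i _.
  by rewrite normr_ge0 normrX lerXn2r ?nnegrE ?mulr_ge0.
rewrite exprMn mulrCA -exprS ler_wpM2l ?exprn_ge0 // ler_weXn2l //.
exact: msize_mdeg_lt.
Qed.

(** Along the ray, the top-degree monomials of [f] contribute exactly [top_form f v * t ^+ msize f]
    to [t * f (t v)]. The remaining ones lose at least one power of [t], and [A] sums their moduli
    at [v]. *)
Lemma meval_ray_ge (K : numFieldType) (n : nat) (f : mpoly n K) (v : 'I_n -> K) :
  exists2 A, 0 <= A & forall t : K, 1 <= t ->
    `|top_form f v| * t ^+ msize f
      <= t * `|meval (fun i => t * v i) f| + A * t ^+ (msize f).-1.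
Proof.
exists (\sum_(m <- msupp f | (mdeg m).+1 != msize f) `|mcoeff m f * \prod_i v i ^+ m i|).
  exact: sumr_ge0.
move=> t t1; have t0 : 0 <= t by apply: le_trans t1.
set r := \sum_(m <- msupp f | (mdeg m).+1 != msize f)
  t * (mcoeff m f * \prod_i (t * v i) ^+ m i).
have tmon (m : multinom n) : t * (mcoeff m f * \prod_i (t * v i) ^+ m i) =
    (mcoeff m f * \prod_i v i ^+ m i) * t ^+ (mdeg m).+1.
  rewrite (eq_bigr (fun i => t ^+ m i * v i ^+ m i)) => [|i _]; last by rewrite exprMn.
  by rewrite big_split /= prodrXr -mdegE exprS; ring.
have split_f : t * meval (fun i => t * v i) f = top_form f v * t ^+ msize f + r.
  rewrite mevalE big_distrr /= (bigID (fun m => (mdeg m).+1 == msize f)) /=.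
  congr (_ + _); rewrite big_distrl /=; apply: eq_bigr => m /eqP <-; exact: tmon.
have r_le : `|r| <= (\sum_(m <- msupp f | (mdeg m).+1 != msize f)
    `|mcoeff m f * \prod_i v i ^+ m i|) * t ^+ (msize f).-1.
  rewrite (le_trans (ler_norm_sum _ _ _)) // big_distrl /=.
  rewrite big_seq_cond [X in _ <= X]big_seq_cond; apply: ler_sum => m /andP[mf ms].
  rewrite tmon normrM ler_wpM2l // ger0_norm ?exprn_ge0 // ler_weXn2l //.
  have := msize_mdeg_lt mf; rewrite leq_eqVlt (negbTE ms) /=.
  by case: (msize f).
rewrite -[X in X <= _]ger0_norm ?mulr_ge0 ?exprn_ge0 // !normrM normr_id -normrM.
rewrite -[X in `|X|](addrK r) -split_f (le_trans (ler_normB _ _)) // normrM.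
by rewrite (ger0_norm t0) lerD2l.
Qed.

(** If [msize g < msize f], the two growth estimates give [|top_form f v| * t ^+ msize f <= (D * C +
    A) * t ^+ (msize f).-1] on a ray with [top_form f v != 0], which fails for large [t]. *)
Lemma msize_le_of_ray_bound (K : numFieldType) (n : nat) (f g : mpoly n K) :
  (forall v : 'I_n -> K, (forall i, v i != 0) ->
    exists M T D : K, [/\ 0 <= M, 0 <= T, 0 <= D &
      forall t, T <= t -> exists2 z : 'I_n -> K, forall i, `|z i| <= M * t &
        `|meval (fun i => t * v i) f| <= D * `|meval z g|]) ->
  (msize f <= msize g)%N.
Proof.
move=> bound; rewrite leqNgt; apply/negP => lt_gf.
have f0 : f != 0 by rewrite -(@msize_poly_eq0 n) -lt0n; apply: leq_ltn_trans lt_gf.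
have [v v0 top0] := top_form_neq0 f0.
have [M [T [D [M0 T0 D0 zP]]]] := bound v v0.
have [C C0 gC] := meval_growth g M0.
have [A A0 fA] := meval_ray_ge f v.
have ntop : 0 < `|top_form f v| by rewrite normr_gt0.
pose B := D * C + A; have B0 : 0 <= B by rewrite addr_ge0 ?mulr_ge0.
(* The three summands ensure [t >= 1], [t >= T] and [t > B / |top_form f v|]. *)
pose t := 1 + T + B / `|top_form f v|.
have q0 : 0 <= B / `|top_form f v| by rewrite divr_ge0.
have t1 : 1 <= t by rewrite /t -addrA lerDl addr_ge0.
have Tt : T <= t by rewrite /t addrAC addrC lerDl addr_ge0.
have tgt0 : 0 < t by apply: lt_le_trans t1.
have [z zM fz] := zP t Tt.
have := fA t t1; apply/negP.
(* The order of [K] is partial: negating [<=] requires real sides, and both are nonnegative. *)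
rewrite -real_ltNge
  ?ger0_real ?addr_ge0 ?mulr_ge0 ?exprn_ge0 ?(ltW tgt0) //.
apply: (@le_lt_trans _ _ (B * t ^+ (msize f).-1)).
  rewrite [leRHS]mulrDl lerD2r; apply: (le_trans (ler_wpM2l (ltW tgt0) fz)).
  rewrite mulrCA -mulrA ler_wpM2l //; apply: (le_trans (gC t z t1 zM)).
  by rewrite ler_wpM2l // ler_weXn2l //; case: (msize f) lt_gf.
rewrite -[in ltRHS](ltn_predK lt_gf) exprS mulrA ltr_pM2r ?exprn_gt0 //.
by rewrite mulrC -ltr_pdivrMr // /t ltrDr ltr_pwDl.
Qed.

(** Finitely many unit balls cover [K], and each coordinate is within 1 of that of some centre. A
    sum over the centres stands in for a maximum. *)
Lemma compact_coord_bounded (R : realType) (n : nat) (K : set (Cspace R n)) :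
  compact (K : set 'rV[R[i]^o]_n) ->
  exists2 B : R[i], 0 <= B & forall x, K x -> forall i, `|x ord0 i| <= B.
Proof.
rewrite compact_cover => /(_ _ K (fun x => (ball x 1)°)) [].
- by move=> x _; apply: open_interior.
- by move=> x Kx; exists x => //; apply: nbhsx_ballx.
move=> D _ KD; pose b (x : 'rV[R[i]^o]_n) : R[i] := \sum_(i < n) `|x ord0 i|.
have b0 x : 0 <= b x by apply: sumr_ge0.
exists (\sum_(x <- D) b x + 1) => [|x Kx i]; first by rewrite addr_ge0 // sumr_ge0.
have [y yD /interior_subset [_ /(_ ord0 i)]] := KD x Kx.
rewrite -ball_normE /= => /ltW xy.
rewrite -[x ord0 i](subKr (y ord0 i)) (le_trans (ler_normB _ _)) // lerD //.
rewrite (bigD1_seq y) //= ?fset_uniq // ler_wpDr ?sumr_ge0 //.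
by rewrite /b (bigD1 i) //= lerDl sumr_ge0.
Qed.

Lemma normc_ge0 (R : rcfType) (z : R[i]) : 0 <= normc z.
Proof. by case: z => a b; exact: sqrtr_ge0. Qed.

Lemma normr_coord_le (R : realType) (n : nat) (x : Cspace R n) (i : 'I_n) :
  `|x ord0 i| <= (euclid_norm x)%:C.
Proof.
have -> : `|x ord0 i| = (Num.sqrt (normc (x ord0 i) ^+ 2))%:C.
  by rewrite sqrtr_sqr (ger0_norm (normc_ge0 _)).
rewrite lecR ler_wsqrtr //.
by rewrite (bigD1 i) //= lerDl sumr_ge0 // => j _; rewrite sqr_ge0.
Qed.

Lemma euclid_norm_le_sum (R : realType) (n : nat) (x : Cspace R n) :
  (euclid_norm x)%:C <= \sum_(i < n) `|x ord0 i|.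
Proof.
rewrite -(rmorph_sum (real_complex R)) lecR /=.
set s := \sum_(i < n) _.
have s0 : 0 <= s by apply: sumr_ge0 => i _; exact: normc_ge0.
have -> : s = Num.sqrt (s ^+ 2) by rewrite sqrtr_sqr ger0_norm.
rewrite ler_wsqrtr // {s0}/s.
(* Each term of the sum [s] is at most [s], so its square is at most itself times [s]. *)
rewrite expr2 big_distrl ler_sum // => i _ /=.
rewrite expr2 ler_wpM2l ?normc_ge0 // (bigD1 i) //= lerDl sumr_ge0 // => j _.
exact: normc_ge0.
Qed.

Lemma euclid_norm_poly_map1 (R : realType) (n : nat) (f : mpoly n R[i])
    (x : Cspace R n) :
  (euclid_norm (poly_map [tuple f] x))%:C
    = `|meval (fun i : 'I_n => (x ord0 i : R[i])) f|.
Proof.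
rewrite /euclid_norm big_ord1 mxE sqrtr_sqr ger0_norm //.
exact: normc_ge0.
Qed.

Lemma msize_le_of_linear_growth (R : realType) (n : nat) (hn : (1 <= n)%N)
    (f g : mpoly n R[i]) (K : set (Cspace R n)) (C1 C2 : R)
    (psi : Cspace R n -> Cspace R n) (y0 : Cspace R n) :
  compact (K : set 'rV[R[i]^o]_n) -> 0 <= C1 -> 0 <= C2 ->
  (forall x, (~` K) x -> euclid_norm (psi x - psi y0) <= C1 * euclid_norm (x - y0)) ->
  (forall x, (~` K) x -> euclid_norm (poly_map [tuple f] x)
     <= C2 * euclid_norm (poly_map [tuple g] (psi x))) ->
  (msize f <= msize g)%N.
Proof.
move=> /compact_coord_bounded[B B0 KB] C10 C20 psi_lip fg.
apply: msize_le_of_ray_bound => v v0.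
pose i0 := Ordinal hn.
pose sv : R[i] := \sum_(i < n) `|v i|; have sv0 : 0 <= sv by apply: sumr_ge0.
pose sy : R[i] := \sum_(i < n) `|y0 ord0 i|; have sy0 : 0 <= sy by apply: sumr_ge0.
pose sp : R[i] := (euclid_norm (psi y0))%:C.
have sp0 : 0 <= sp by rewrite ler0c sqrtr_ge0.
have C1c : 0 <= C1%:C :> R[i] by rewrite ler0c.
have q0 : 0 <= B / `|v i0| by rewrite divr_ge0.
(* For [t >= 1], [|psi (t v)| <= |psi y0| + C1 * |t v - y0| <= (sp + C1 * (sv + sy)) * t]. The
   threshold forces [t * |v i0| > B], so [t v] lies outside [K]. *)
exists (sp + C1%:C * (sv + sy)), (1 + B / `|v i0|), C2%:C; split.
- by rewrite addr_ge0 ?mulr_ge0 ?addr_ge0.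
- by rewrite addr_ge0.
- by rewrite ler0c.
move=> t Tt; have t1 : 1 <= t by apply: le_trans Tt; rewrite lerDl.
have t0 : 0 < t by apply: lt_le_trans t1.
pose x : Cspace R n := \row_i (t * v i : R[i]).
have nKx : (~` K) x.
  move=> /KB /(_ i0); rewrite mxE normrM (gtr0_norm t0) => tB.
  have : t <= B / `|v i0| by rewrite ler_pdivlMr ?normr_gt0.
  by move=> /(le_trans Tt); rewrite gerDr ler10.
exists (fun i => psi x ord0 i) => [i|].
  have -> : psi x ord0 i = psi y0 ord0 i + (psi x - psi y0) ord0 i.
    by rewrite !mxE [RHS]addrC subrK.
  rewrite (le_trans (ler_normD _ _)) // mulrDl lerD //.
    by rewrite (le_trans (normr_coord_le _ _)) // ler_peMr.
  rewrite (le_trans (normr_coord_le _ _)) //.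
  have : (euclid_norm (psi x - psi y0))%:C <= (C1 * euclid_norm (x - y0))%:C :> R[i].
    by rewrite lecR psi_lip.
  move=> /le_trans; apply; rewrite rmorphM /= -mulrA ler_wpM2l //.
  rewrite (le_trans (euclid_norm_le_sum _)) //.
  rewrite mulrDl /sv /sy !big_distrl -big_split ler_sum // => j _ /=.
  rewrite !mxE (le_trans (ler_normB _ _)) // lerD //.
    by rewrite normrM (gtr0_norm t0) mulrC.
  by rewrite ler_peMr.
have := fg x nKx; rewrite -lecR rmorphM /= !euclid_norm_poly_map1.
rewrite (@meval_eq _ _ (fun i => x ord0 i) (fun i => t * v i)) // => i.
by rewrite mxE.
Qed.

(* msize p is deg p + 1 for p != 0, and msize 0 = 0. *)
Theorem theorem3p10 (R : realType) (n : nat) (hn : (1 <= n)%N)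
    (f g : mpoly n R[i]) :
  weakly_rugose_equiv_infty [tuple f] [tuple g] ->
  msize f = msize g.
Proof.
move=> [K [K' [C1 [C2 [phi [cK cK' C10 C20 [[y0 [w0 [Ky Kw lip lip']]] eqv]]]]]]].
apply/eqP; rewrite eqn_leq; apply/andP; split.
  (* The lower half of the two-sided estimate bounds [f] by [g] composed with [phi]. *)
  apply: (msize_le_of_linear_growth hn cK (ltW C10) (ltW C20) lip) => x /eqv/andP[+ _].
  by rewrite mulrC ler_pdivrMr // mulrC.
(* The upper half, taken at [phi^-1 z], bounds [g z] by [f (phi^-1 z)]. For [z] outside [K'],
   [phi^-1 z] lies outside [K] and [phi] sends it back to [z]. *)
apply: (msize_le_of_linear_growth hn cK' (ltW C10) (ltW C20) lip') => z K'z.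
have phiK : phi (phi^-1%FUN z) = z by apply: invK; apply: mem_set.
have Kphi : (~` K) (phi^-1%FUN z) by apply: (@funS _ _ _ _ (phi^-1)%FUN).
by have /andP[_] := eqv _ Kphi; rewrite phiK.
Qed.
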